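(* Let $\sigma$ be a uniform random permutation of the set $[n]=\{1,\dots,n\}$. For an arbitrary function $f\colon S_n\to\mathbb{R}$ and any $r\ge2$, $$\|f(\sigma)-\mathbb{E}f(\sigma)\|_r\le D\sqrt r\,\Bigl\|\Bigl(\frac1{n+2}\sum_{i,j=1}^n(f(\sigma)-f(\sigma\circ\tau_{ij}))^2\Bigr)^{1/2}\Bigr\|_r$$ and $$\|(f(\sigma)-\mathbb{E}f(\sigma))_+\|_r\le D\sqrt r\,\Bigl\|\Bigl(\frac1{n+2}\sum_{i,j=1}^n(f(\sigma)-f(\sigma\circ\tau_{ij}))_+^2\Bigr)^{1/2}\Bigr\|_r,$$ where $D=\sqrt{\frac{\sqrt e}{\sqrt e-1}}$.
   Context: $S_n$ is the symmetric group of permutations of $[n]$; $\tau_{ij}$ is the transposition of $i$ and $j$ ($\tau_{ii}$ is the identity). $\|Y\|_r=(\mathbb{E}|Y|^r)^{1/r}$; $t_+=\max(t,0)$. *)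

(* Defs.v *)
From HB Require Import structures.
From mathcomp Require Import all_boot all_order all_algebra all_fingroup.
From mathcomp Require Import all_classical all_reals all_analysis.

Set Implicit Arguments.
Unset Strict Implicit.
Unset Printing Implicit Defensive.

Import Order.TTheory GRing.Theory Num.Theory.
Local Open Scope classical_set_scope.
Local Open Scope ring_scope.

(* A random permutation sigma of 'I_n, on an arbitrary probability space, that
   is uniformly distributed. As 'S_n is finite and discrete, measurability of
   sigma is measurability of its fibres. *)
Definition uniform_permutation (d : measure_display) (T : measurableType d)
    (R : realType) (P : probability T R) (n : nat) (sigma : T -> 'S_n) : Prop :=
  forall s : 'S_n, measurable (sigma @^-1` [set s]) /\
    P (sigma @^-1` [set s]) = ((n`!%:R)^-1)%:E.

(* MathComp's product of permutations composes from left to right. *)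
Definition perm_comp (n : nat) (s t : 'S_n) : 'S_n := (t * s)%g.

Lemma perm_compE (n : nat) (s t : 'S_n) : perm_comp s t =1 s \o t.
Proof. by move=> i; rewrite /perm_comp permM. Qed.

Definition rnorm (d : measure_display) (T : measurableType d) (R : realType)
    (P : probability T R) (r : R) (Y : T -> R) : \bar R :=
  Lnorm P r%:E (EFin \o Y).

Definition pos_part (R : realType) (t : R) : R := Num.max t 0.

Definition constD (R : realType) : R :=
  Num.sqrt (Num.sqrt (expR 1) / (Num.sqrt (expR 1) - 1)).

(* Main.v *)
(* Write p = 1 + s with 0 <= s <= 1 and phi(x, y) = (x - y)(x^s - y^s).  The
   Bregman divergence of x^p is jointly convex on positive reals, hence so is
   its symmetrization, a multiple of phi.  Conditioning on the position of one
   point, and using Jensen's inequality for phi to compare coset averages, one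
   proves by induction on the number of points Beckner's inequality
     E f^p - (E f)^p <= 1/(2(n+2)) sum_(i,j) E phi(f, f o tau_ij)   (f > 0).
   Applied to f = Y^(q-1) with p = q/(q-1), it gives, for q >= 2,
     E Y^q <= (E Y^(q-1))^(q/(q-1)) + (q-1) E (Y^(q-2) V),
   where V is the one-sided variation of Y.  With v = ||V||_(r/2) and Hoelder's
   inequality, induction on q in steps of one yields ||Y||_q^2 <= D^2 q v:
   otherwise division by E Y^q would contradict
   (1 - 1/q)^(q/2) + 1/D^2 <= e^(-1/2) + (1 - e^(-1/2)) = 1.
   The induction starts from the Poincare inequality, the case p = 2.  One takes
   for Y the absolute value, or the positive part, of f - E f. *)
Require Import Defs.
From HB Require Import structures.
From mathcomp Require Import all_boot all_order all_algebra all_fingroup.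
From mathcomp Require Import all_classical all_reals all_analysis.
From mathcomp Require Import ring lra.

Set Implicit Arguments.
Unset Strict Implicit.
Unset Printing Implicit Defensive.

Import Order.TTheory GRing.Theory Num.Theory.
Import numFieldNormedType.Exports.
Local Open Scope ring_scope.

(** * Convexity of powers *)

Section powR_inequalities.
Variable R : realType.
Implicit Types (a b s x y t : R).

(** Weighted AM-GM. It is used for tangent lines, for the second derivative of [bregman] and for
    Hoelder's inequality. *)
Lemma powR_young s x t : 0 <= s <= 1 -> 0 < x -> 0 < t ->
  x `^ (1 - s) * t `^ s <= (1 - s) * x + s * t.
Proof.
move=> /andP[s0 s1] x0 t0.
set m := x `^ (1 - s) * t `^ s.
have mE : m = expR ((1 - s) * ln x + s * ln t).
  by rewrite /m /powR !gt_eqF// -expRD.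
pose u := ln x - ln t.
have m0 : 0 < m by rewrite mE expR_gt0.
(* Both endpoints are bounded below by the tangent of [expR] at [ln m]. *)
have xE : x = m * expR (s * u).
  rewrite mE -expRD -[LHS]lnK ?posrE//; congr expR; rewrite /u; ring.
have tE : t = m * expR (- (1 - s) * u).
  rewrite mE -expRD -[LHS]lnK ?posrE//; congr expR; rewrite /u; ring.
have hx : m * (1 + s * u) <= x by rewrite [leRHS]xE ler_pM2l// expR_ge1Dx.
have ht : m * (1 + (- (1 - s) * u)) <= t by rewrite [leRHS]tE ler_pM2l// expR_ge1Dx.
have := lerD (ler_wpM2l (_ : 0 <= 1 - s) hx) (ler_wpM2l s0 ht).
rewrite subr_ge0 => /(_ s1); apply: le_trans.
by rewrite le_eqVlt; apply/orP; left; apply/eqP; ring.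
Qed.

Lemma powR_tangent_concave s x y : 0 <= s <= 1 -> 0 < x -> 0 < y ->
  y `^ s <= x `^ s + s * x `^ (s - 1) * (y - x).
Proof.
move=> s01 x0 y0.
have := powR_young s01 x0 y0.
have h : x `^ s = x * x `^ (s - 1).
  by rewrite -{2}(powRr1 (ltW x0)) -powRD ?(gt_eqF x0) ?implybT//; congr powR; ring.
have k : x `^ (1 - s) * x `^ (s - 1) = 1.
  by rewrite -powRD ?(gt_eqF x0) ?implybT// (_ : _ + _ = 0) ?powRr0//; ring.
move=> /(ler_wpM2r (powR_ge0 x (s - 1))).
by rewrite mulrAC k mul1r h => /le_trans; apply; rewrite le_eqVlt; apply/orP; left; apply/eqP; ring.
Qed.

(** This is the concave tangent inequality with exponent [a^-1] at the [a]-th powers of [x] and [y],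
    solved for the power of [y]. *)
Lemma powR_tangent_convex a x y : 1 <= a -> 0 < x -> 0 < y ->
  x `^ a + a * x `^ (a - 1) * (y - x) <= y `^ a.
Proof.
move=> a1 x0 y0; have a0 : 0 < a by lra.
have s01 : 0 <= a^-1 <= 1 by rewrite invr_ge0 ltW//= invf_le1.
have xa0 : 0 < x `^ a by exact: powR_gt0.
have := powR_tangent_concave s01 xa0 (powR_gt0 a y0).
rewrite -!powRrM divff ?gt_eqF// (powRr1 (ltW x0)) (powRr1 (ltW y0)).
have -> : a * (a^-1 - 1) = 1 - a by field; rewrite gt_eqF.
have k : x `^ (1 - a) * x `^ (a - 1) = 1.
  by rewrite -powRD ?(gt_eqF x0) ?implybT// (_ : _ + _ = 0) ?powRr0//; ring.
have c0 : 0 <= a * x `^ (a - 1) by rewrite mulr_ge0 ?powR_ge0// ltW.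
rewrite -lerBlDl => /(ler_wpM2l c0) h.
have e : a * x `^ (a - 1) * (a^-1 * x `^ (1 - a) * (y `^ a - x `^ a))
   = y `^ a - x `^ a.
  transitivity (a * a^-1 * (x `^ (1 - a) * x `^ (a - 1)) * (y `^ a - x `^ a)).
    by ring.
  by rewrite k divff ?gt_eqF// !mul1r.
move: h; rewrite e; lra.
Qed.

(** The mean value theorem for [F] on [0, 1], then for [F1] on [0, c], gives F 1 - F 0 = F1 c >= F1
    0. *)
Lemma convex_tangent01 (F F1 F2 : R -> R) :
  (forall th : R, th \in `[0, 1] -> is_derive th 1 F (F1 th)) ->
  (forall th : R, th \in `[0, 1] -> is_derive th 1 F1 (F2 th)) ->
  (forall th : R, th \in `[0, 1] -> 0 <= F2 th) ->
  F 0 + F1 0 <= F 1.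
Proof.
move=> dF dF1 F2_ge0.
have cont (G G' : R -> R) c : c <= 1 ->
    (forall th : R, th \in `[0, 1] -> is_derive th 1 G (G' th)) ->
    ({within `[0%R, c], continuous G})%classic.
  move=> c1 dG; apply: derivable_within_continuous => th.
  rewrite in_itv/= => /andP[th0 thc].
  have /dG[//] : th \in `[0, 1] by rewrite in_itv/= th0 (le_trans thc).
have sub (c th : R) : c <= 1 -> th \in `]0, c[ -> th \in `[0, 1].
  rewrite !in_itv/= => c1 /andP[th0 thc].
  by rewrite (ltW th0) (le_trans (ltW thc)).
have [c c01 Fc] := MVT ltr01 (fun th h => dF th (sub _ _ (lexx 1) h))
  (cont _ _ _ (lexx 1) dF).
move: (c01); rewrite in_itv/= => /andP[c0 c1].
have [e e0c F1e] := MVT c0 (fun th h => dF1 th (sub _ _ (ltW c1) h))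
  (cont _ _ _ (ltW c1) dF1).
have : 0 <= F2 e * (c - 0).
  by rewrite mulr_ge0 ?subr0 ?(ltW c0)//; apply: F2_ge0; exact: sub (ltW c1) e0c.
by rewrite -F1e; move: Fc; rewrite subr0 mulr1; lra.
Qed.

Lemma is_derive_line (u v th : R) : is_derive th 1 (fun z => u + z * v) v.
Proof.
apply: (@is_derive_eq _ _ _ (cst u + (id * cst v))) => //.
by rewrite scaler0 !add0r /GRing.scale/= mulr1.
Qed.

Lemma is_derive_powR_line (e u v th : R) : 0 < u + th * v ->
  is_derive th 1 (fun z => (u + z * v) `^ e) (e * (u + th * v) `^ (e - 1) * v).
Proof.
move=> h.
exact: (@is_derive1_comp _ (fun z => z `^ e) (fun z => u + z * v) _ _ _
  (is_derive1_powR _ h)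
  (is_derive_line u v th)).
Qed.

(* The Bregman divergence at [(x, t)] of the power function with exponent [1 + s]. *)
Definition bregman s x t := x `^ (1 + s) - (1 + s) * (t `^ s * x) + s * t `^ (1 + s).

(** Joint convexity as a supporting plane at (a, b), with the partial derivatives as slopes. Along
    the segment to (x, t) it reduces to the sign of the second derivative [F2]. *)
Lemma bregman_tangent s a b x t : 0 <= s <= 1 ->
  0 < a -> 0 < b -> 0 < x -> 0 < t ->
  bregman s a b + ((1 + s) * (a `^ s - b `^ s) * (x - a)
     + (1 + s) * s * (b `^ s - b `^ (s - 1) * a) * (t - b)) <= bregman s x t.
Proof.
move=> s01 a0 b0 x0 t0.
set dx := x - a; set dt := t - b.
pose X th := a + th * dx; pose T th := b + th * dt.
have line_gt0 (u w th : R) : 0 < u -> 0 < w -> th \in `[0, 1] -> 0 < u + th * (w - u).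
  rewrite in_itv/= => u0 w0 /andP[th0 th1].
  have -> : u + th * (w - u) = (1 - th) * u + th * w by ring.
  move: th0; rewrite le_eqVlt => /predU1P[<-|th0].
    by rewrite subr0 mul1r mul0r addr0.
  by rewrite ltr_wpDl ?mulr_gt0// mulr_ge0 ?subr_ge0// ltW.
have Xgt0 (th : R) : th \in `[0, 1] -> 0 < X th by exact: line_gt0.
have Tgt0 (th : R) : th \in `[0, 1] -> 0 < T th by exact: line_gt0.
have dX (e th : R) : th \in `[0, 1] ->
    is_derive th 1 (fun z => X z `^ e) (e * X th `^ (e - 1) * dx).
  by move=> /Xgt0; exact: is_derive_powR_line.
have dT (e th : R) : th \in `[0, 1] ->
    is_derive th 1 (fun z => T z `^ e) (e * T th `^ (e - 1) * dt).
  by move=> /Tgt0; exact: is_derive_powR_line.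
have dX1 (th : R) : is_derive th 1 X dx by exact: is_derive_line.
pose F1 th := (1 + s) * ((X th `^ s - T th `^ s) * dx
    + s * (T th `^ s - T th `^ (s - 1) * X th) * dt).
pose F2 th := (1 + s) * s * (X th `^ (s - 1) * dx ^+ 2
    - 2 * T th `^ (s - 1) * dx * dt
    + (s * T th `^ (s - 1) + (1 - s) * (T th `^ (s - 2) * X th)) * dt ^+ 2).
have e1 : 1 + s - 1 = s by ring.
have e2 : s - 1 - 1 = s - 2 by ring.
have := @convex_tangent01 (fun th => bregman s (X th) (T th)) F1 F2.
rewrite /F1 /= /X /T !mul0r !addr0 !mul1r /dx /dt !subrKC -/dx -/dt.
rewrite mulrDr !mulrA; apply.
- move=> th h.
  have := is_deriveD (is_deriveB (dX (1 + s) th h)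
     (is_deriveZ (1 + s) (is_deriveM (dT s th h) (dX1 th))))
     (is_deriveZ s (dT (1 + s) th h)).
  move=> /is_derive_eq; apply.
  by rewrite /GRing.scale/= e1 /X /T; ring.
- move=> th h.
  have := is_deriveZ (1 + s) (is_deriveD
     (is_deriveZ dx (is_deriveB (dX s th h) (dT s th h)))
     (is_deriveZ (s * dt) (is_deriveB (dT s th h)
        (is_deriveM (dT (s - 1) th h) (dX1 th))))).
  move=> /is_derive_eq -/(_ (F2 th)).
  set G := (G in is_derive _ _ G _) => H.
  rewrite (_ : (fun z => _) = G); last first.
    apply/funext => z.
    transitivity ((1 + s) * (dx * (X z `^ s - T z `^ s) +
      (s * dt) * (T z `^ s - T z `^ (s - 1) * X z))) => //.
    by rewrite /X /T; ring.
  apply: H.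
  by rewrite /GRing.scale/= e2 /F2; ring.
- move=> th h; have X0 := Xgt0 _ h; have T0 := Tgt0 _ h.
  have /andP[s0 s1] := s01.
  rewrite /F2; apply: mulr_ge0; first by rewrite mulr_ge0 ?addr_ge0.
  set A := X th `^ (s - 1); set B := T th `^ (s - 1).
  have pT u v : T th `^ (u + v) = T th `^ u * T th `^ v.
    by rewrite powRD ?(gt_eqF T0) ?implybT.
  have BE : B = T th `^ (s - 2) * T th.
    by rewrite -{2}(powRr1 (ltW T0)) -pT; congr powR; ring.
  have A0 : 0 <= A by exact: powR_ge0.
  (* [q] completes the square: the quadratic form is A (dx - q dt)^2 plus a multiple of dt^2, whose
     coefficient is nonnegative by [powR_young]. *)
  pose q := B * X th `^ (1 - s).
  have Aq : A * q = B.
    rewrite /q mulrCA -powRD ?(gt_eqF X0) ?implybT//.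
    by rewrite (_ : _ + _ = 0) ?powRr0 ?mulr1//; ring.
  have Bq : B * q <= s * B + (1 - s) * (T th `^ (s - 2) * X th).
    have -> : B * q = T th `^ (s - 2) * (X th `^ (1 - s) * T th `^ s).
      rewrite /q {1}/B /B.
      rewrite (_ : T th `^ (s - 2) * _ = X th `^ (1 - s) * (T th `^ (s - 2) * T th `^ s)); last by ring.
      rewrite -pT mulrA -pT mulrC; congr (_ * powR _ _); ring.
    have -> : s * B + (1 - s) * (T th `^ (s - 2) * X th) =
        T th `^ (s - 2) * ((1 - s) * X th + s * T th) by rewrite BE; ring.
    by rewrite ler_wpM2l ?powR_ge0// powR_young.
  apply: (@le_trans _ _ (A * (dx - q * dt) ^+ 2)); first by rewrite mulr_ge0 ?sqr_ge0.
  have -> : A * (dx - q * dt) ^+ 2 =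
    A * dx ^+ 2 - 2 * B * dx * dt + B * q * dt ^+ 2 by rewrite -Aq; ring.
  by rewrite lerD2l ler_wpM2r ?sqr_ge0.
Qed.

End powR_inequalities.

Section beckner_energy.
Variable R : realType.
Implicit Types (s a b x y : R).

(* [(1 + s) * phi s x y = bregman s x y + bregman s y x], so [phi] inherits joint convexity. *)
Definition phi s x y := (x - y) * (x `^ s - y `^ s).

Lemma phixx s x : phi s x x = 0.
Proof. by rewrite /phi subrr mul0r. Qed.

Lemma phiC s x y : phi s x y = phi s y x.
Proof. by rewrite /phi; ring. Qed.

Lemma phi_ge0 s x y : 0 <= s -> 0 < x -> 0 < y -> 0 <= phi s x y.
Proof.
move=> s0; wlog xy : x y / x <= y => [H x0 y0|x0 y0].
  by have [/H|/ltW/H] := leP x y; [exact|rewrite phiC; exact].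
rewrite /phi mulr_le0// subr_le0// ge0_ler_powR// nnegrE ltW//.
Qed.

Lemma powR1D s x : 0 < x -> x `^ (1 + s) = x * x `^ s.
Proof. by move=> x0; rewrite powRD ?(gt_eqF x0) ?implybT// powRr1 ?ltW. Qed.

(** Two Bregman tangents with exchanged arguments are added. Jensen's inequality only asks that some
    slopes exist. *)
Lemma phi_tangent s a b : 0 <= s <= 1 -> 0 < a -> 0 < b ->
  exists c d, forall x y, 0 < x -> 0 < y ->
    phi s a b + (c * (x - a) + d * (y - b)) <= phi s x y.
Proof.
move=> s01 a0 b0; have s1 : 0 < 1 + s by lra.
have phiE x y : 0 < x -> 0 < y ->
    phi s x y = (1 + s)^-1 * (bregman s x y + bregman s y x).
  move=> x0 y0; rewrite /phi /bregman !powR1D//; field.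
  by rewrite gt_eqF.
pose c u v := (1 + s) * (u `^ s - v `^ s) : R.
pose d u v := (1 + s) * s * (v `^ s - v `^ (s - 1) * u) : R.
exists ((1 + s)^-1 * (c a b + d b a)), ((1 + s)^-1 * (d a b + c b a)) => x y x0 y0.
rewrite !phiE// -2!mulrA -!mulrDr ler_pM2l ?invr_gt0//.
have := lerD (bregman_tangent s01 a0 b0 x0 y0) (bregman_tangent s01 b0 a0 y0 x0).
by rewrite -/(c a b) -/(d a b) -/(c b a) -/(d b a); lra.
Qed.

End beckner_energy.

(** * Averages over finite sets and groups *)

Section average.
Variables (R : realType) (T : finType).
Implicit Types (A : {set T}) (F G : T -> R).

Definition avg A F : R := #|A|%:R^-1 * \sum_(i in A) F i.

Lemma eq_avg A F G : {in A, F =1 G} -> avg A F = avg A G.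
Proof. by move=> FG; congr (_ * _); apply: eq_bigr => i /FG. Qed.

Lemma ler_avg A F G : (forall i, i \in A -> F i <= G i) -> avg A F <= avg A G.
Proof. by move=> FG; rewrite ler_wpM2l ?invr_ge0// ler_sum. Qed.

Lemma avgD A F G : avg A (fun i => F i + G i) = avg A F + avg A G.
Proof. by rewrite /avg big_split mulrDr. Qed.

Lemma avgZl A c F : avg A (fun i => c * F i) = c * avg A F.
Proof. by rewrite /avg -mulr_sumr mulrCA. Qed.

Lemma avgZr A c F : avg A (fun i => F i * c) = avg A F * c.
Proof. by rewrite mulrC -avgZl; apply: eq_avg => i _; rewrite mulrC. Qed.

Lemma avgB A F G : avg A (fun i => F i - G i) = avg A F - avg A G.
Proof. by rewrite /avg sumrB mulrBr. Qed.

Lemma avg_sum A (I : Type) (r : seq I) (P : pred I) (F : I -> T -> R) :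
  avg A (fun i => \sum_(k <- r | P k) F k i) = \sum_(k <- r | P k) avg A (F k).
Proof. by rewrite /avg exchange_big mulr_sumr. Qed.

Lemma avg_cst A c : (0 < #|A|)%N -> avg A (fun=> c) = c.
Proof.
move=> A0; rewrite /avg sumr_const -[c *+ _]mulr_natr mulrC mulfK//.
by rewrite pnatr_eq0 -lt0n.
Qed.

Lemma avg_set1 (x : T) F : avg [set x]%SET F = F x.
Proof. by rewrite /avg cards1 big_set1 invr1 mul1r. Qed.

Lemma avg_ge0 A F : (forall i, i \in A -> 0 <= F i) -> 0 <= avg A F.
Proof. by move=> F0; rewrite mulr_ge0 ?invr_ge0// sumr_ge0. Qed.

Lemma avg_gt0 A F : (0 < #|A|)%N -> (forall i, i \in A -> 0 < F i) -> 0 < avg A F.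
Proof.
move=> A0 F0; rewrite mulr_gt0 ?invr_gt0 ?ltr0n//.
have /card_gt0P[i iA] := A0.
rewrite (bigD1 i)//= ltr_wpDr ?F0// sumr_ge0// => j /andP[jA _].
by rewrite ltW ?F0.
Qed.

(** Jensen's inequality: the supporting plane at the two means is averaged, and its linear terms
    vanish. *)
Lemma avg_phi s A F G : (0 < #|A|)%N -> 0 <= s <= 1 ->
  (forall i, 0 < F i) -> (forall i, 0 < G i) ->
  phi s (avg A F) (avg A G) <= avg A (fun i => phi s (F i) (G i)).
Proof.
move=> A0 s01 F0 G0.
have [c [d H]] := phi_tangent s01 (avg_gt0 A0 (fun i _ => F0 i))
  (avg_gt0 A0 (fun i _ => G0 i)).
have := ler_avg (fun i (_ : i \in A) => H _ _ (F0 i) (G0 i)).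
by rewrite !avgD !avgZl !avgB !avg_cst// !subrr !mulr0 !addr0.
Qed.

Lemma avg_powR_concave s A F : (0 < #|A|)%N -> 0 <= s <= 1 -> (forall i, 0 < F i) ->
  avg A (fun i => F i `^ s) <= avg A F `^ s.
Proof.
move=> A0 s01 F0; have m0 := avg_gt0 A0 (fun i _ => F0 i).
have := ler_avg (fun i (_ : i \in A) => powR_tangent_concave s01 m0 (F0 i)).
by rewrite avgD avgZl avgB !avg_cst// subrr mulr0 addr0.
Qed.

(** The double average of [phi] equals 2 (E F^(1+s) - E F E F^s), and E F^s <= (E F)^s by
    concavity. *)
Lemma entropy_le_energy s A F : (0 < #|A|)%N -> 0 <= s <= 1 -> (forall i, 0 < F i) ->
  avg A (fun i => F i `^ (1 + s)) - avg A F `^ (1 + s) <=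
  2^-1 * avg A (fun i => avg A (fun j => phi s (F i) (F j))).
Proof.
move=> A0 s01 F0; have m0 := avg_gt0 A0 (fun i _ => F0 i).
rewrite powR1D//; under eq_avg do rewrite powR1D//.
have -> : avg A (fun i => avg A (fun j => phi s (F i) (F j))) =
    2 * (avg A (fun i => F i * F i `^ s) - avg A F * avg A (fun i => F i `^ s)).
  transitivity (avg A (fun i => F i * F i `^ s + avg A (fun j => F j * F j `^ s)
      - (F i * avg A (fun j => F j `^ s) + avg A F * F i `^ s))).
    apply: eq_avg => i _.
    rewrite -[in RHS](avg_cst (F i * F i `^ s) A0) -avgZl -avgZr -!avgD -avgB.
    by apply: eq_avg => j _; rewrite /phi; ring.
  by rewrite avgB !avgD avgZl avgZr !avg_cst//; ring.
rewrite mulrA mulVf// mul1r lerD2l lerN2 ler_pM2l//.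
exact: avg_powR_concave.
Qed.

End average.

Lemma exchange_avg (R : realType) (T T' : finType) (A : {set T}) (B : {set T'})
    (F : T -> T' -> R) :
  avg A (fun i => avg B (F i)) = avg B (fun j => avg A (F^~ j)).
Proof. by rewrite /avg -!mulr_sumr exchange_big/= mulrCA. Qed.

Section group_average.
Variables (R : realType) (gT : finGroupType).
Implicit Types (G H : {group gT}) (F : gT -> R).

Lemma avg_mulgl G x F : x \in G -> avg G (fun g => F (x * g)%g) = avg G F.
Proof.
move=> xG; rewrite /avg [in RHS](reindex_inj (mulgI x))/=; congr (_ * _).
by apply: eq_bigl => g; rewrite groupMl.
Qed.

Lemma avg_mulgr G x F : x \in G -> avg G (fun g => F (g * x)%g) = avg G F.
Proof.
move=> xG; rewrite /avg [in RHS](reindex_inj (mulIg x))/=; congr (_ * _).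
by apply: eq_bigl => g; rewrite groupMr.
Qed.

Lemma avg_setT_mulgl x F :
  avg [set: gT] (fun g => F (x * g)%g) = avg [set: gT] F.
Proof. exact: (@avg_mulgl [set: gT]%G). Qed.

Lemma avg_subgroup G H F : H \subset G ->
  avg G (fun g => avg H (fun h => F (h * g)%g)) = avg G F.
Proof.
move=> /fintype.subsetP HG; rewrite [LHS]exchange_avg/=.
rewrite -[RHS](avg_cst _ (cardG_gt0 H)).
by apply: eq_avg => h /HG hG; exact: avg_mulgl.
Qed.

(** [entropy_le_energy] is applied on each right coset of [G]. Two points h g and h' g differ by the
    left factor h' h^-1, which is again uniform on [G], so translations leave a single average over
    [G]. *)
Lemma beckner_group s G F : 0 <= s <= 1 -> (forall g, 0 < F g) ->
  avg [set: gT] (fun g => F g `^ (1 + s))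
    - avg [set: gT] (fun g => avg G (fun h => F (h * g)%g) `^ (1 + s)) <=
  2^-1 * avg G (fun h => avg [set: gT] (fun g => phi s (F g) (F (h * g)%g))).
Proof.
move=> s01 F0.
have -> : avg [set: gT] (fun g => F g `^ (1 + s)) =
    avg [set: gT] (fun g => avg G (fun h => F (h * g)%g `^ (1 + s))).
  by rewrite (@avg_subgroup [set: gT]%G G (fun g => F g `^ (1 + s)))// finset.subsetT.
rewrite -avgB.
apply: le_trans (ler_avg (fun g (_ : g \in [set: gT]) =>
  entropy_le_energy (cardG_gt0 G) s01 (fun h => F0 (h * g)%g))) _.
rewrite avgZl ler_pM2l ?invr_gt0// le_eqVlt; apply/orP; left; apply/eqP.
rewrite [LHS]exchange_avg/=.
rewrite -[RHS](avg_cst _ (cardG_gt0 G)).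
apply: eq_avg => h hG; rewrite [LHS]exchange_avg/=.
rewrite -[in RHS](avg_mulgr _ (groupVr hG)).
apply: eq_avg => h' h'G.
rewrite -[in RHS](avg_setT_mulgl h); apply: eq_avg => g _.
by rewrite mulgA mulgKV.
Qed.

End group_average.

(** * Beckner's inequality on the symmetric group *)

Section symmetric_group.
Variables (R : realType) (n : nat).
Implicit Types (A : {set 'I_n}) (i j m : 'I_n) (f : 'S_n -> R).

Lemma tperm_Sym A i j : i \in A -> j \in A -> tperm i j \in Sym A.
Proof.
move=> iA jA; rewrite inE; apply: (fintype.subset_trans (tperm_on i j)).
by apply/fintype.subsetP => k; rewrite !inE => /orP[]/eqP->.
Qed.

(** Transpositions inside [A] show that the choice of [m] does not matter. After averaging over that
    choice, each [h] merely permutes the terms of the sum over [A]. *)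
Lemma avg_Sym_point A m (F : 'I_n -> R) : m \in A ->
  avg (Sym A) (fun h : 'S_n => F (h m)) = avg A F.
Proof.
move=> mA; have A0 : (0 < #|A|)%N by apply/card_gt0P; exists m.
have E i : i \in A ->
    avg (Sym A) (fun h : 'S_n => F (h m)) = avg (Sym A) (fun h : 'S_n => F (h i)).
  move=> iA; rewrite -(avg_mulgl _ (tperm_Sym iA mA)).
  by apply: eq_avg => h _; rewrite permM tpermR.
rewrite -[LHS](avg_cst _ A0) (eq_avg E) [LHS]exchange_avg/=.
rewrite -[RHS](avg_cst _ (cardG_gt0 (Sym_group A))); apply: eq_avg => h.
rewrite inE => hA; rewrite /avg; congr (_ * _).
rewrite [RHS](reindex_inj (@perm_inj _ h))/=; apply: eq_bigl => i.
by rewrite perm_closed.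
Qed.

Lemma Sym_D1_fix A m (h : 'S_n) : h \in Sym (A :\ m) -> h m = m.
Proof. by rewrite inE => /out_perm; apply; rewrite !inE eqxx. Qed.

(** Products act from left to right, so [tperm i j * g] is g composed after the transposition, as in
    the theorem. *)
Definition transposition_energy s f i j :=
  avg [set: 'S_n] (fun g => phi s (f g) (f (tperm i j * g)%g)).

Lemma transposition_energyxx s f i : transposition_energy s f i i = 0.
Proof.
rewrite /transposition_energy /avg big1 ?mulr0// => g _.
by rewrite tperm1 mul1g phixx.
Qed.

Lemma transposition_energy_ge0 s f i j : 0 <= s -> (forall g, 0 < f g) ->
  0 <= transposition_energy s f i j.
Proof. by move=> s0 f0; apply: avg_ge0 => g _; exact: phi_ge0. Qed.

(** Averaging over the stabilizer of [m] leaves a function that varies only between cosets, so its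
    energy can be charged to the transpositions [tperm m j]. *)
Lemma energy_avg_Sym_D1 s A m f (F : 'S_n -> R) :
  0 <= s <= 1 -> (forall g, 0 < f g) -> m \in A ->
  (forall g, F g = avg (Sym (A :\ m)) (fun h => f (h * g)%g)) ->
  avg (Sym A) (fun h => avg [set: 'S_n] (fun g => phi s (F g) (F (h * g)%g))) <=
  avg A (transposition_energy s f m).
Proof.
move=> s01 f0 mA FE.
have FH (h g : 'S_n) : h \in Sym (A :\ m) -> F (h * g)%g = F g.
  move=> hH; rewrite !FE -[RHS](avg_mulgr _ hH).
  by apply: eq_avg => k _; rewrite mulgA.
(* [F] is constant on the right cosets of [Sym (A :\ m)] in [Sym A], which are
   represented by the transpositions [tperm m j]. *)
have -> : avg (Sym A) (fun h => avg [set: 'S_n] (fun g => phi s (F g) (F (h * g)%g))) =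
    avg A (fun j => avg [set: 'S_n] (fun g => phi s (F g) (F (tperm m j * g)%g))).
  rewrite -(avg_Sym_point _ mA); apply: eq_avg => h hA; apply: eq_avg => g _.
  congr (phi _ _ _); rewrite -[in LHS](mulgKV (tperm m (h m)) h) -mulgA FH//.
  have kA : (h * (tperm m (h m))^-1)%g \in Sym A.
    by rewrite groupM// groupV tperm_Sym//; move: hA; rewrite inE => /perm_closed->.
  rewrite inE; apply/fintype.subsetP => i; rewrite !inE => ki; apply/andP; split.
    by apply: contraNneq ki => ->; rewrite permM tpermV tpermR.
  by move: kA; rewrite inE => /fintype.subsetP; apply; rewrite inE.
have H0 := cardG_gt0 (Sym_group (A :\ m)).
(* Jensen's inequality for [phi] brings the coset averages outside. Since [h] fixes [m], moving [h]
   past [tperm m j] replaces [j] by its image under [h^-1]. *)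
apply: (@le_trans _ _ (avg A (fun j => avg (Sym (A :\ m)) (fun h =>
    transposition_energy s f m ((h^-1)%g j))))).
  apply: ler_avg => j jA.
  apply: (@le_trans _ _ (avg [set: 'S_n] (fun g => avg (Sym (A :\ m)) (fun h =>
      phi s (f (h * g)%g) (f (h * (tperm m j * g))%g))))).
    by apply: ler_avg => g _; rewrite !FE; exact: avg_phi.
  rewrite [leLHS]exchange_avg/=.
  apply: ler_avg => h hH; rewrite /transposition_energy.
  rewrite -[leRHS](avg_setT_mulgl h) le_eqVlt; apply/orP; left; apply/eqP.
  apply: eq_avg => g _; congr (phi _ _ (f _)).
  have -> : tperm m ((h^-1)%g j) = (tperm m j ^ h^-1)%g.
    by rewrite tpermJ (@Sym_D1_fix A m)// groupV.
  by rewrite conjgE invgK !mulgA mulgKV.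
(* [h^-1] permutes [A], so the average over [j] does not depend on [h]. *)
rewrite [leLHS]exchange_avg/=.
rewrite -[leRHS](avg_cst _ H0); apply: ler_avg => h hH.
rewrite le_eqVlt; apply/orP; left; apply/eqP; rewrite /avg; congr (_ * _).
rewrite [RHS](reindex_inj (@perm_inj _ h^-1%g))/=; apply: eq_bigl => i.
rewrite perm_closed//; have : (h^-1)%g \in Sym (A :\ m) by rewrite groupV.
by rewrite inE => /fintype.subset_trans; apply; exact: finset.subD1set.
Qed.

(** The induction on the size of [A] calls for this conditional form, with the entropy taken inside
    the right cosets of [Sym A]. *)
Lemma beckner_Sym s A f : 0 <= s <= 1 -> (forall g, 0 < f g) ->
  avg [set: 'S_n] (fun g => f g `^ (1 + s))
    - avg [set: 'S_n] (fun g => avg (Sym A) (fun h => f (h * g)%g) `^ (1 + s)) <=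
  (2 * #|A|.+2%:R)^-1 * \sum_(i in A) \sum_(j in A) transposition_energy s f i j.
Proof.
move=> s01 f0; have [k kA] := ubnP #|A|; elim: k A kA => // k IHk A.
rewrite ltnS => kA.
have s0 : 0 <= s by case/andP: s01.
set Q := transposition_energy s f.
(* The induction starts where [Sym A] is trivial and the left side vanishes. *)
have [A2|A2] := leqP #|A| 1.
  have Sym1 : Sym A = [set 1%g].
    apply/esym/eqP; rewrite eqEcard; apply/andP; split.
      by rewrite finset.sub1set group1.
    by rewrite card_Sym cards1; case: #|A| A2 => [|[|]].
  rewrite Sym1; under [X in _ - X]eq_avg do rewrite avg_set1 mul1g.
  rewrite subrr mulr_ge0//.
  by rewrite sumr_ge0// => i _; rewrite sumr_ge0// => j _; exact: transposition_energy_ge0.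
set L := (X in X <= _).
(* Condition on the point [m] first; the factor [#|A|.+2] comes out of averaging
   this bound over [m], each pair [i != j] surviving for [#|A| - 2] choices. *)
have step m : m \in A ->
    L <= (2 * #|A|.+1%:R)^-1 * (\sum_(i in A :\ m) \sum_(j in A :\ m) Q i j)
       + 2^-1 * avg A (Q m).
  move=> mA.
  pose F g := avg (Sym (A :\ m)) (fun h => f (h * g)%g).
  have F0 g : 0 < F g by apply: avg_gt0 => //; exact: (cardG_gt0 (Sym_group _)).
  have cA : #|A| = #|A :\ m|.+1 by rewrite (cardsD1 m A) mA.
  have /IHk : (#|A :\ m| < k)%N by rewrite -cA.
  rewrite -/Q -cA -/F => h1.
  have h2 := beckner_group (Sym_group A) s01 F0.
  have h3 := energy_avg_Sym_D1 s01 f0 mA (fun=> erefl).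
  have FA g : avg (Sym A) (fun h => F (h * g)%g) = avg (Sym A) (fun h => f (h * g)%g).
    have HG : Sym (A :\ m) \subset Sym A.
      apply/fintype.subsetP => h; rewrite !inE => /fintype.subset_trans; apply.
      exact: finset.subD1set.
    rewrite -[RHS](avg_subgroup (G := Sym_group A) (H := Sym_group _) _ HG).
    by apply: eq_avg => h _; apply: eq_avg => k' _; rewrite mulgA.
  have := le_trans h2 (ler_wpM2l (_ : 0 <= 2^-1) h3).
  rewrite invr_ge0 ler0n => /(_ isT).
  under [X in _ - X <= _ -> _]eq_avg do rewrite FA.
  (* Chain rule: the entropy inside the cosets of [Sym (A :\ m)] and that of the coset averages [F]
     add up, and the middle terms cancel. *)
  move=> /(lerD h1); apply: le_trans.
  by rewrite addrA subrK.
pose K : R := #|A|%:R; have K2 : 2 <= K by rewrite ler_nat.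
set S := \sum_(i in A) _.
have S0 : 0 <= S.
  by rewrite sumr_ge0// => i _; rewrite sumr_ge0// => j _; exact: transposition_energy_ge0.
have sumD1 m : m \in A -> \sum_(i in A :\ m) \sum_(j in A :\ m) Q i j =
    S - \sum_(j in A) Q m j - \sum_(i in A) Q i m.
  move=> mA; have D1 i : \sum_(j in A :\ m) Q i j = \sum_(j in A) Q i j - Q i m.
    by rewrite [X in _ = X - _](big_setD1 m)//= [X in _ = X - _]addrC addrK.
  under eq_bigr do rewrite D1.
  rewrite sumrB.
  have -> : S = \sum_(j in A) Q m j + \sum_(i in A :\ m) \sum_(j in A) Q i j.
    exact: big_setD1.
  have -> : \sum_(i in A) Q i m = \sum_(i in A :\ m) Q i m.
    by rewrite (big_setD1 m)//= /Q transposition_energyxx add0r.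
  by ring.
have : \sum_(m in A) L <= \sum_(m in A)
    ((2 * #|A|.+1%:R)^-1 * (\sum_(i in A :\ m) \sum_(j in A :\ m) Q i j)
     + 2^-1 * avg A (Q m)).
  exact: ler_sum.
have sumS : \sum_(m in A) \sum_(i in A :\ m) \sum_(j in A :\ m) Q i j = (K - 2) * S.
  transitivity (\sum_(m in A) (S - \sum_(j in A) Q m j - \sum_(i in A) Q i m)).
    exact: eq_bigr.
  rewrite sumrB sumrB sumr_const -/S [X in _ - X = _]exchange_big/= -/S.
  by rewrite -mulr_natl -/K; ring.
rewrite sumr_const big_split/= -mulr_sumr sumS -mulr_sumr -[L *+ _]mulr_natr -/K.
have -> : \sum_(m in A) avg A (Q m) = K^-1 * S by rewrite /avg -mulr_sumr.
have -> : #|A|.+1%:R = K + 1 by rewrite -natr1.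
have -> : #|A|.+2%:R = K + 2 by rewrite -natrD addn2.
clearbody K S; move=> h.
have {h}: L * K <= ((2 * (K + 1))^-1 * (K - 2) + (2 * K)^-1) * S.
  apply: le_trans h _; rewrite le_eqVlt; apply/orP; left; apply/eqP.
  field; apply/andP; split; lra.
move=> /le_trans -/(_ (K * (2 * (K + 2))^-1 * S)) h.
(* The shift by 2 closes the induction: the new coefficient exceeds the old one by (K - 2) / (2 K (K
   + 1) (K + 2)), which is 0 at K = 2. *)
have : L * K <= K * (2 * (K + 2))^-1 * S.
  apply: h; rewrite ler_wpM2r// -subr_ge0.
  rewrite (_ : _ - _ = (K - 2) / (2 * K * (K + 1) * (K + 2))).
    by rewrite divr_ge0 ?mulr_ge0; lra.
  field; repeat (apply/andP; split); lra.
by rewrite mulrC -mulrA ler_pM2l//; lra.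
Qed.

End symmetric_group.

(** * Moment estimates *)

Section moment_recursion.
Variables (R : realType) (n : nat).
Implicit Types (f Y V : 'S_n -> R) (q r v : R).

Local Notation E := (avg [set: 'S_n]).

Lemma card_setT_group_gt0 (gT : finGroupType) : (0 < #|[set: gT]|)%N.
Proof. exact: (cardG_gt0 [set: gT]%G). Qed.

Lemma beckner_permutations (s : R) f : 0 <= s <= 1 -> (forall g, 0 < f g) ->
  E (fun g => f g `^ (1 + s)) - E f `^ (1 + s) <=
  (2 * (n + 2)%:R)^-1 * \sum_i \sum_j transposition_energy s f i j.
Proof.
move=> s01 f0; have := beckner_Sym [set: 'I_n]%SET s01 f0.
have -> : Sym [set: 'I_n]%SET = [set: 'S_n].
  apply/setP => g; rewrite !inE; apply/fintype.subsetP => i _; by rewrite inE.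
under [X in _ - X <= _ -> _]eq_avg => g _.
  rewrite (@avg_mulgr _ _ [set: 'S_n]%G) ?inE//; over.
rewrite avg_cst ?card_setT_group_gt0// cardsT card_ord addn2.
rewrite [in X in _ <= X -> _](eq_bigl xpredT) => [|i]; last by rewrite inE.
by under [in X in _ <= X -> _]eq_bigr => i _ do
  (rewrite (eq_bigl xpredT); last by move=> j; rewrite inE).
Qed.

Definition oneside_variation Y (g : 'S_n) : R := (n + 2)%:R^-1 *
  \sum_i \sum_j pos_part (Y g - Y (tperm i j * g)%g) ^+ 2.

Lemma pos_part_ge0 (x : R) : 0 <= pos_part x.
Proof. by rewrite /pos_part le_max lexx orbT. Qed.

Lemma oneside_variation_ge0 Y g : 0 <= oneside_variation Y g.
Proof.
by rewrite mulr_ge0 ?invr_ge0// sumr_ge0// => i _; rewrite sumr_ge0// => j _; exact: sqr_ge0.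
Qed.

Lemma avg_tperm_swap (H : R -> R -> R) Y i j :
  E (fun g => H (Y g) (Y (tperm i j * g)%g)) = E (fun g => H (Y (tperm i j * g)%g) (Y g)).
Proof.
rewrite -(avg_setT_mulgl (tperm i j)); apply: eq_avg => g _.
by rewrite mulgA tperm2 mul1g.
Qed.

(** For y <= x only the first positive part survives, and the tangent to z^(q-1) at x gives the
    bound. The second term makes it symmetric. *)
Lemma phi_powR_le q (x y : R) : 2 <= q -> 0 < x -> 0 < y ->
  phi (q - 1)^-1 (x `^ (q - 1)) (y `^ (q - 1)) <=
  (q - 1) * (x `^ (q - 2) * pos_part (x - y) ^+ 2 + y `^ (q - 2) * pos_part (y - x) ^+ 2).
Proof.
move=> q2; wlog xy : x y / y <= x => [H x0 y0|x0 y0].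
  have [/H|/ltW/H] := leP y x; first by apply.
  by move=> h; rewrite phiC [X in _ <= _ * X]addrC; exact: h.
have q1 : q - 1 != 0 by rewrite gt_eqF//; lra.
rewrite /phi -!powRrM divff// (powRr1 (ltW x0)) (powRr1 (ltW y0)).
rewrite /pos_part max_l ?subr_ge0// max_r ?subr_le0// expr0n/= mulr0 addr0.
have := @powR_tangent_convex _ (q - 1) x y _ x0 y0.
rewrite (_ : q - 1 - 1 = q - 2); last by ring.
have xy0 : 0 <= x - y by lra.
move=> h.
have {}h : x `^ (q - 1) - y `^ (q - 1) <= (q - 1) * x `^ (q - 2) * (x - y).
  have := h (_ : 1 <= q - 1); lra.
by apply: le_trans (ler_wpM2r xy0 h) _; rewrite -!mulrA -expr2.
Qed.

(** [V] is just an upper bound, because [Y] will be an absolute value or a positive part while [V]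
    is a variation of [f] itself. *)
Lemma moment_step Y V q : 2 <= q -> (forall g, 0 < Y g) ->
  (forall g, oneside_variation Y g <= V g) ->
  E (fun g => Y g `^ q) <= E (fun g => Y g `^ (q - 1)) `^ (q / (q - 1))
    + (q - 1) * E (fun g => Y g `^ (q - 2) * V g).
Proof.
move=> q2 Y0 WV; have q1 : 0 < q - 1 by lra.
pose s := (q - 1)^-1; have s01 : 0 <= s <= 1.
  by rewrite invr_ge0 ltW//= invf_le1//; lra.
(* Beckner's inequality with exponent [1 + s = q / (q - 1)] for [Y `^ (q - 1)]. *)
have := beckner_permutations s01 (fun g => powR_gt0 (q - 1) (Y0 g)).
have sE : 1 + s = q / (q - 1) by rewrite /s; field; rewrite gt_eqF.
have -> : E (fun g => (Y g `^ (q - 1)) `^ (1 + s)) = E (fun g => Y g `^ q).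
  by apply: eq_avg => g _; rewrite -powRrM sE mulrCA divff ?mulr1// gt_eqF.
rewrite sE lerBlDl => /le_trans; apply; rewrite lerD2l.
apply: (@le_trans _ _ ((q - 1) * E (fun g => Y g `^ (q - 2) * oneside_variation Y g))); last first.
  by rewrite ler_pM2l//; apply: ler_avg => g _; rewrite ler_wpM2l ?powR_ge0.
have N0 : 0 < (n + 2)%:R :> R by rewrite ltr0n addn2.
pose B i j := E (fun g => Y g `^ (q - 2) * pos_part (Y g - Y (tperm i j * g)%g) ^+ 2).
have -> : E (fun g => Y g `^ (q - 2) * oneside_variation Y g) =
    (n + 2)%:R^-1 * \sum_i \sum_j B i j.
  transitivity (E (fun g => (n + 2)%:R^-1 * \sum_i \sum_j
      (Y g `^ (q - 2) * pos_part (Y g - Y (tperm i j * g)%g) ^+ 2))).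
    apply: eq_avg => g _; rewrite /oneside_variation mulrCA mulr_sumr.
    by congr (_ * _); apply: eq_bigr => i _; rewrite mulr_sumr.
  by rewrite avgZl avg_sum; congr (_ * _); apply: eq_bigr => i _; rewrite avg_sum.
have -> : (q - 1) * ((n + 2)%:R^-1 * (\sum_i \sum_j B i j)) =
    (2 * (n + 2)%:R)^-1 * \sum_i \sum_j (2 * (q - 1) * B i j).
  under [in RHS]eq_bigr do rewrite -mulr_sumr.
  by rewrite -mulr_sumr; field; rewrite gt_eqF.
rewrite ler_pM2l ?invr_gt0 ?mulr_gt0//.
apply: ler_sum => i _; apply: ler_sum => j _.
apply: le_trans (ler_avg (fun g _ => phi_powR_le q2 (Y0 g) (Y0 _))) _.
rewrite avgZl avgD.
(* The two halves of the bound have equal means under the swap, which accounts for the 2 in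
   Beckner's constant. *)
have -> : E (fun g => Y (tperm i j * g)%g `^ (q - 2)
    * pos_part (Y (tperm i j * g)%g - Y g) ^+ 2) = B i j.
  by rewrite /B -(avg_tperm_swap (fun x y => y `^ (q - 2) * pos_part (y - x) ^+ 2))
             (avg_tperm_swap (fun x y => y `^ (q - 2) * pos_part (y - x) ^+ 2)).
by rewrite -/(B i j) le_eqVlt; apply/orP; left; apply/eqP; ring.
Qed.

(** Hoelder's inequality, proved pointwise for the normalized y = Y^q / a and w = V / v. Young's
    inequality bounds y^(1-2/q) w by means of w^(q/2), and then w^(q/2) by means of 1 and w^(r/2).
    On averaging, the coefficients sum to 1. *)
Lemma avg_hoelder Y V q r v : 2 <= q -> q <= r -> 0 < v ->
  (forall g, 0 < Y g) -> (forall g, 0 <= V g) ->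
  E (fun g => V g `^ (r / 2)) <= v `^ (r / 2) ->
  E (fun g => Y g `^ (q - 2) * V g) <= E (fun g => Y g `^ q) `^ (1 - 2 / q) * v.
Proof.
move=> q2 qr v0 Y0 V0 EV.
have q0 : 0 < q by lra.
have r0 : 0 < r by lra.
set a := E (fun g => Y g `^ q).
have a0 : 0 < a by apply: avg_gt0 => [|g _]; [exact: card_setT_group_gt0|exact: powR_gt0].
set c := a `^ (1 - 2 / q) * v.
have c0 : 0 < c by rewrite mulr_gt0 ?powR_gt0.
have vr0 : 0 < v `^ (r / 2) by exact: powR_gt0.
suff H g : Y g `^ (q - 2) * V g <=
    c * ((1 - 2 / q) * (a^-1 * Y g `^ q) + (2 / q - 2 / r) +
         2 / r * ((v `^ (r / 2))^-1 * V g `^ (r / 2))).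
  apply: (le_trans (ler_avg (fun g _ => H g))).
  rewrite avgZl !avgD !avgZl !avg_cst ?card_setT_group_gt0// -/a mulVf ?gt_eqF//.
  rewrite -[leRHS]mulr1 ler_pM2l//.
  have : 2 / r * ((v `^ (r / 2))^-1 * E (fun g => V g `^ (r / 2))) <= 2 / r * 1.
    by rewrite ler_pM2l ?divr_gt0// ler_pdivrMl// mulr1.
  lra.
(* [powR_young] takes positive arguments, so a zero of [V] is treated apart. *)
have := V0 g; rewrite le_eqVlt => /predU1P[<-|Vg].
  rewrite mulr0; apply: mulr_ge0; first exact: ltW.
  apply: addr_ge0; first apply: addr_ge0.
  - apply: mulr_ge0; last by rewrite mulr_ge0 ?invr_ge0 ?powR_ge0 ?(ltW a0).
    by rewrite subr_ge0 ler_pdivrMr// mul1r.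
  - by rewrite subr_ge0 ler_pM2l// lef_pV2// posrE.
  - by rewrite !mulr_ge0 ?invr_ge0 ?powR_ge0 ?(ltW r0) ?(ltW vr0).
set y := a^-1 * Y g `^ q; have y0 : 0 < y by rewrite mulr_gt0 ?invr_gt0 ?powR_gt0.
set w := v^-1 * V g; have w0 : 0 < w by rewrite mulr_gt0 ?invr_gt0.
have wE : (v `^ (r / 2))^-1 * V g `^ (r / 2) = w `^ (r / 2).
  by rewrite /w powRM ?invr_ge0 ?(ltW v0) ?(ltW Vg)// -(powR_inv1 (ltW v0)) -powRrM mulN1r powRN.
have -> : Y g `^ (q - 2) * V g = c * (y `^ (1 - 2 / q) * w).
  have -> : y `^ (1 - 2 / q) = (a `^ (1 - 2 / q))^-1 * Y g `^ (q - 2).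
    rewrite /y powRM ?invr_ge0 ?powR_ge0 ?(ltW a0)//; congr (_ * _).
      by rewrite -powR_inv1 ?(ltW a0)// -powRrM mulN1r powRN.
    by rewrite -powRrM; congr powR; field; rewrite gt_eqF.
  by rewrite /c /w; field; rewrite !gt_eqF// powR_gt0.
rewrite ler_pM2l// wE.
have s1 : 0 <= 2 / q <= 1 by rewrite divr_ge0 ?(ltW q0)//= ler_pdivrMr// mul1r.
have s2 : 0 <= q / r <= 1 by rewrite divr_ge0 ?(ltW q0) ?(ltW r0)//= ler_pdivrMr// mul1r.
have h1 := powR_young s1 y0 (powR_gt0 (q / 2) w0).
have h2 := powR_young s2 (@ltr01 R) (powR_gt0 (r / 2) w0).
move: h1; rewrite -powRrM (_ : q / 2 * (2 / q) = 1); last by field; rewrite gt_eqF.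
rewrite (powRr1 (ltW w0)) => /le_trans; apply.
move: h2; rewrite powR1 mul1r -powRrM (_ : r / 2 * (q / r) = q / 2); last by field; rewrite gt_eqF.
have p0 : 0 <= 2 / q by case/andP: s1.
move=> /(ler_wpM2l p0).
have -> : 2 / q * ((1 - q / r) * 1 + q / r * w `^ (r / 2)) =
   2 / q - 2 / r + 2 / r * w `^ (r / 2) by field; rewrite !gt_eqF.
lra.
Qed.

End moment_recursion.

Section moment_bound.
Variables (R : realType) (n : nat).
Implicit Types (Y V f : 'S_n -> R) (q r v : R).

Local Notation E := (avg [set: 'S_n]).

(** In this form the constant satisfies e^(-1/2) + 1/D^2 = 1, the identity that closes the
    recursion. *)
Lemma constD_sqr : constD R ^+ 2 = (1 - expR (- 2^-1))^-1.
Proof.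
have e0 : expR (2^-1) != 0 :> R by rewrite gt_eqF ?expR_gt0.
have e1 : 0 < 1 - expR (- 2^-1) :> R by rewrite subr_gt0 expR_lt1; lra.
have sE : Num.sqrt (expR 1) = expR (2^-1) :> R.
  have -> : expR 1 = expR (2^-1) ^+ 2 :> R by rewrite expr2 -expRD; congr expR; field.
  by rewrite sqrtr_sqr ger0_norm// expR_ge0.
have cE : Num.sqrt (expR 1) / (Num.sqrt (expR 1) - 1) = (1 - expR (- 2^-1))^-1 :> R.
  rewrite sE; move: e1; rewrite expRN => e1.
  have : expR (2^-1) - 1 != 0 :> R.
    by rewrite gt_eqF// subr_gt0 expR_gt1; lra.
  by move=> e2; field; rewrite e0 e2.
by rewrite /constD sqr_sqrtr cE// invr_ge0 ltW.
Qed.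

(** The lower bound gives D^2 >= 2, which starts the recursion. *)
Lemma expR_half_bounds : 2^-1 <= expR (- 2^-1) :> R /\ expR (- 2^-1) < 1 :> R.
Proof.
split; last by rewrite expR_lt1; lra.
by apply: le_trans (expR_ge1Dx _); lra.
Qed.

(** The bound 1 - 1/q <= e^(-1/q) is raised to the power q/2. *)
Lemma powR_one_minus_inv q : 1 < q -> (1 - q^-1) `^ (q / 2) <= expR (- 2^-1).
Proof.
move=> q1; have q0 : 0 < q by lra.
have -> : expR (- 2^-1) = expR (- q^-1) `^ (q / 2) :> R.
  by rewrite /powR gt_eqF ?expR_gt0// expRK; congr expR; field; rewrite gt_eqF.
apply: ge0_ler_powR; rewrite ?divr_ge0 ?(ltW q0)// ?nnegrE ?expR_ge0//.
  by rewrite subr_ge0 invf_le1// ltW.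
exact: expR_ge1Dx.
Qed.

Lemma moment_bound_recursion Y V r v : 2 <= r -> 0 < v ->
  (forall g, 0 < Y g) ->
  (forall g, oneside_variation Y g <= V g) ->
  E (fun g => Y g ^+ 2) <= 2 * v ->
  E (fun g => V g `^ (r / 2)) <= v `^ (r / 2) ->
  forall q, 1 <= q <= r ->
    E (fun g => Y g `^ q) <= (constD R ^+ 2 * q * v) `^ (q / 2).
Proof.
move=> r2 v0 Y0 WV EY EV q.
have [d_ge d_lt] := expR_half_bounds.
rewrite constD_sqr; set d := expR _ in d_ge d_lt *.
(* Here [D] stands for the square of [constD], so that d + 1/D = 1. *)
set D := (1 - d)^-1; have d1 : 0 < 1 - d by lra.
have D0 : 0 < D by rewrite invr_gt0.
have D2 : 2 <= D by rewrite -lef_pV2 ?posrE// invrK; lra.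
have V0 g : 0 <= V g by apply: le_trans (oneside_variation_ge0 Y g) (WV g).
(* For real [q] the induction runs over an integer [k] with q <= k + 2. The base covers 1 <= q <= 2,
   where E Y^q <= (E Y^2)^(q/2). *)
have [k kq] : exists k : nat, q <= k%:R + 2.
  by exists (Num.truncn q); have := truncnS_gt q; rewrite -natr1; lra.
elim: k q kq => [|k IHk] q kq /andP[q1 qr].
  rewrite add0r in kq.
  apply: (@le_trans _ _ ((2 * v) `^ (q / 2))); last first.
    have Dq : 2 <= D * q by rewrite -[2]mulr1 ler_pM.
    by apply: ge0_ler_powR; rewrite ?nnegrE ?ler_pM2r// ?mulr_ge0 ?(ltW v0) ?(ltW D0)//; lra.
  apply: (@le_trans _ _ (E (fun g => Y g ^+ 2) `^ (q / 2))); last first.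
    apply: ge0_ler_powR => //; rewrite ?nnegrE; [lra| |lra].
    by apply: avg_ge0 => g _; exact: sqr_ge0.
  have s01 : 0 <= q / 2 <= 1 by lra.
  apply: le_trans (avg_powR_concave (card_setT_group_gt0 _) s01 (fun g => exprn_gt0 2 (Y0 g))).
  apply: ler_avg => g _; rewrite -powR_mulrn ?(ltW (Y0 g))// -powRrM.
  by rewrite (_ : 2 * (q / 2) = q)//; field.
have [q2|q2] := ltP q 2.
  have k0 : 0 <= k%:R :> R by exact: ler0n.
  by apply: IHk; [lra|rewrite q1].
have q0 : 0 < q by lra.
set a := E (fun g => Y g `^ q).
have a0 : 0 < a by apply: avg_gt0 => [|g _]; [exact: card_setT_group_gt0|exact: powR_gt0].
set B := (D * q * v) `^ (q / 2).
have Bb0 : 0 < D * q * v by rewrite !mulr_gt0.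
(* Suppose a > B. The two terms of [moment_step] are then at most B d and a (1 - d), whose sum is
   less than a. *)
have [//|Ba] := leP a B.
have b_le : E (fun g => Y g `^ (q - 1)) `^ (q / (q - 1)) <= B * d.
  have /IHk h : q - 1 <= k%:R + 2 by move: kq; rewrite -natr1; lra.
  have {}h := h (_ : 1 <= q - 1 <= r).
  apply: (@le_trans _ _ ((D * (q - 1) * v) `^ (q / 2))).
    have -> : (D * (q - 1) * v) `^ (q / 2) = ((D * (q - 1) * v) `^ ((q - 1) / 2)) `^ (q / (q - 1)).
      by rewrite -powRrM; congr powR; field; lra.
    apply: ge0_ler_powR; rewrite ?nnegrE ?powR_ge0//.
    - by rewrite divr_ge0; lra.
    - by apply: avg_ge0 => g _; exact: powR_ge0.
    - by apply: h; lra.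
  have -> : D * (q - 1) * v = D * q * v * (1 - q^-1) by field; lra.
  rewrite powRM ?(ltW Bb0)//; last by rewrite subr_ge0 invf_le1.
  by rewrite -/B ler_wpM2l ?powR_ge0// powR_one_minus_inv//; lra.
have h_le : (q - 1) * E (fun g => Y g `^ (q - 2) * V g) <= a * (1 - d).
  apply: (@le_trans _ _ ((q - 1) * (a `^ (1 - 2 / q) * v))).
    by rewrite ler_wpM2l ?(avg_hoelder q2 qr)//; lra.
  (* The assumption a > B, raised to the power 2/q, lets a power of [a] absorb the factor [v]. *)
  have aq : D * q * v < a `^ (2 / q).
    have -> : D * q * v = B `^ (2 / q).
      rewrite /B -powRrM (_ : q / 2 * (2 / q) = 1); last by field; lra.
      by rewrite powRr1// ltW.
    by apply: gt0_ltr_powR; rewrite ?divr_gt0 ?nnegrE ?powR_ge0 ?(ltW a0).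
  have aE : a = a `^ (1 - 2 / q) * a `^ (2 / q).
    rewrite -powRD ?(gt_eqF a0) ?implybT// subrK powRr1//; exact: ltW.
  have p0 : 0 < a `^ (1 - 2 / q) by exact: powR_gt0.
  rewrite [in leRHS]aE mulrCA -[leRHS]mulrA ler_pM2l//.
  apply: (@le_trans _ _ (D * q * v * (1 - d))); last by rewrite ler_wpM2r ?(ltW aq) ?(ltW d1).
  rewrite (_ : D * q * v * (1 - d) = q * v); first by rewrite ler_pM2r//; lra.
  by rewrite /D; field; lra.
have := moment_step q2 Y0 WV; rewrite -/a => h.
have d0 : 0 < d by exact: expR_gt0.
have : B * d < a * d by rewrite ltr_pM2r.
by lra.
Qed.

End moment_bound.

Section permutation_moments.
Variables (R : realType) (n : nat).
Implicit Types (Y V f : 'S_n -> R) (q r v : R).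

Local Notation E := (avg [set: 'S_n]).

(** This is [avg_hoelder] with q = 2 and Y = 1. *)
Lemma avg_le_of_moment V r v : 2 <= r -> 0 < v -> (forall g, 0 <= V g) ->
  E (fun g => V g `^ (r / 2)) <= v `^ (r / 2) -> E V <= v.
Proof.
move=> r2 v0 V0 EV.
have := avg_hoelder (lexx 2) r2 v0 (fun=> @ltr01 R) V0 EV.
rewrite divff// !subrr !powRr0 mul1r; apply: le_trans.
by rewrite le_eqVlt; apply/orP; left; apply/eqP/eq_avg => g _; rewrite mul1r.
Qed.

Lemma moment_bound Y V r : 2 <= r -> (forall g, 0 <= Y g) ->
  (forall g, oneside_variation Y g <= V g) ->
  E (fun g => Y g ^+ 2) <= E V ->
  E (fun g => Y g `^ r) `^ r^-1 <=
  constD R * Num.sqrt r * E (fun g => V g `^ (r / 2)) `^ r^-1.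
Proof.
move=> r2 Y0 WV EY; have r0 : 0 < r by lra.
have V0 g : 0 <= V g by apply: le_trans (oneside_variation_ge0 Y g) (WV g).
set a := E (fun g => Y g `^ r); set b := E (fun g => V g `^ (r / 2)).
have a0 : 0 <= a by apply: avg_ge0 => g _; exact: powR_ge0.
have b0 : 0 <= b by apply: avg_ge0 => g _; exact: powR_ge0.
have half (x : R) : 0 <= x -> (x `^ (2 / r)) = (x `^ r^-1) ^+ 2.
  by move=> x0; rewrite -powR_mulrn ?powR_ge0// -powRrM mulrC.
have C0 : 0 < constD R ^+ 2.
  by rewrite constD_sqr invr_gt0 subr_gt0; case: (expR_half_bounds R).
suff ab : a `^ (2 / r) <= constD R ^+ 2 * r * b `^ (2 / r).
  have c0 : 0 <= constD R by exact: sqrtr_ge0.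
  rewrite -(@ler_pXn2r _ 2%N) ?nnegrE ?powR_ge0 ?mulr_ge0 ?sqrtr_ge0 ?powR_ge0//.
  by move: ab; rewrite (half a a0) (half b b0) 2!exprMn (sqr_sqrtr (ltW r0)).
apply/ler_addgt0Pr => e e0.
set K := constD R ^+ 2 * r; have K0 : 0 < K by rewrite mulr_gt0.
(* The recursion asks for v > 0. The slack is chosen so that K v exceeds the target by exactly
   [e]. *)
set v := b `^ (2 / r) + e / K.
have v0 : 0 < v by rewrite ltr_wpDl ?powR_ge0// divr_gt0.
have Ev : b <= v `^ (r / 2).
  apply: (@le_trans _ _ ((b `^ (2 / r)) `^ (r / 2))).
    by rewrite -powRrM (_ : 2 / r * (r / 2) = 1) ?powRr1//; field; rewrite gt_eqF.
  apply: ge0_ler_powR; rewrite ?nnegrE ?powR_ge0 ?(ltW v0)//; first lra.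
  by rewrite lerDl divr_ge0// ltW.
(* The shift makes [Y] positive without changing its variation. *)
pose eps := Num.sqrt (v / 6).
have eps0 : 0 < eps by rewrite sqrtr_gt0 divr_gt0.
have eps2 : eps ^+ 2 = v / 6 by rewrite sqr_sqrtr// divr_ge0// ltW.
pose Z g := Y g + eps.
have Z0 g : 0 < Z g by rewrite ltr_wpDl.
have WZ g : oneside_variation Z g <= V g.
  apply: le_trans (WV g); rewrite le_eqVlt; apply/orP; left; apply/eqP.
  congr (_ * _); apply: eq_bigr => i _; apply: eq_bigr => j _.
  by congr (pos_part _ ^+ 2); rewrite /Z; ring.
have EZ : E (fun g => Z g ^+ 2) <= 2 * v.
  (* The weights come from (Y - 2 eps)^2 >= 0. With eps^2 = v/6 and E Y^2 <= v the total is 3v/2 +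
     v/2 = 2v. *)
  apply: (@le_trans _ _ (E (fun g => 3 / 2 * Y g ^+ 2 + 3 * eps ^+ 2))).
    apply: ler_avg => g _; rewrite /Z.
    by have := sqr_ge0 (Y g - 2 * eps); nra.
  rewrite avgD avgZl avg_cst ?card_setT_group_gt0// eps2.
  by have := avg_le_of_moment r2 v0 V0 Ev; lra.
have := @moment_bound_recursion _ _ Z V r v r2 v0 Z0 WZ EZ Ev r.
rewrite lexx andbT => h; have {}h := h (le_trans (_ : 1 <= 2) r2).
apply: (@le_trans _ _ (K * v)); last first.
  by rewrite /v mulrDr lerD2l mulrCA divff ?mulr1// gt_eqF.
have -> : K * v = ((K * v) `^ (r / 2)) `^ (2 / r).
  rewrite -powRrM (_ : r / 2 * (2 / r) = 1); last by field; rewrite gt_eqF.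
  by rewrite powRr1 ?(ltW (mulr_gt0 K0 v0)).
apply: ge0_ler_powR; rewrite ?nnegrE ?powR_ge0// ?divr_ge0 ?(ltW r0)//.
apply: le_trans (h _); last by rewrite ler1n.
apply: ler_avg => g _; apply: ge0_ler_powR; rewrite ?nnegrE ?(ltW r0) ?(ltW (Z0 g))//.
by rewrite /Z lerDl ltW.
Qed.

(** Beckner's inequality with s = 1, where [phi] is the squared difference. Adding the constant [C]
    makes [f] positive and changes neither side. *)
Lemma variance_permutations f :
  E (fun g => (f g - E f) ^+ 2) <=
  (2 * (n + 2)%:R)^-1 * \sum_i \sum_j E (fun g => (f g - f (tperm i j * g)%g) ^+ 2).
Proof.
set m := E f; pose C := 1 + \sum_g `|f g|.
pose F g := f g + C.
have F0 g : 0 < F g.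
  have : `|f g| <= \sum_g `|f g| by rewrite [leRHS](bigD1 g)//= lerDl sumr_ge0.
  by have := ler_norm (- f g); rewrite normrN /F /C; lra.
have E0 := @card_setT_group_gt0 'S_n.
have := beckner_permutations (_ : 0 <= 1 <= 1) F0.
rewrite ler01 lexx => /(_ isT).
have EF0 : 0 < E F by apply: avg_gt0.
have -> : 1 + 1 = 2 :> R by [].
rewrite powR_mulrn ?(ltW EF0)//.
under eq_avg do rewrite powR_mulrn ?(ltW (F0 _))//.
have -> : E (fun g => F g ^+ 2) - E F ^+ 2 = E (fun g => (f g - m) ^+ 2).
  have EF : E F = m + C by rewrite avgD avg_cst.
  have -> : E (fun g => (f g - m) ^+ 2) =
      E (fun g => F g ^+ 2 - 2 * (m + C) * F g + (m + C) ^+ 2).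
    by apply: eq_avg => g _; rewrite /F; ring.
  by rewrite [RHS]avgD avgB avgZl avg_cst// EF; ring.
move=> /le_trans; apply; rewrite ler_pM2l; last by rewrite invr_gt0 mulr_gt0// ltr0n addn2.
apply: ler_sum => i _; apply: ler_sum => j _; rewrite le_eqVlt; apply/orP; left; apply/eqP.
apply: eq_avg => g _; rewrite /phi !powRr1 ?(ltW (F0 _))// /F; ring.
Qed.

Definition twoside_variation f (g : 'S_n) : R := (n + 2)%:R^-1 *
  \sum_i \sum_j (f g - f (tperm i j * g)%g) ^+ 2.

Lemma pos_part_sqrD (x : R) : x ^+ 2 = pos_part x ^+ 2 + pos_part (- x) ^+ 2.
Proof.
rewrite /pos_part; have /orP[x0|x0] := le_total 0 x.
  by rewrite max_l// max_r ?oppr_le0// expr0n/= addr0.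
by rewrite max_r// max_l ?oppr_ge0// expr0n/= add0r sqrrN.
Qed.

Lemma pos_part_le_norm (x : R) : pos_part x <= `|x|.
Proof. by rewrite /pos_part ge_max ler_norm normr_ge0. Qed.

Lemma avg_variation (H : R -> R -> R) f :
  E (fun g => (n + 2)%:R^-1 * \sum_i \sum_j H (f g) (f (tperm i j * g)%g)) =
  (n + 2)%:R^-1 * \sum_i \sum_j E (fun g => H (f g) (f (tperm i j * g)%g)).
Proof.
by rewrite avgZl avg_sum; congr (_ * _); apply: eq_bigr => i _; rewrite avg_sum.
Qed.

(** Each squared difference splits into two squared positive parts, which have equal means under the
    swap. *)
Lemma avg_twoside_variation f :
  E (twoside_variation f) = 2 * E (oneside_variation f).
Proof.
rewrite (avg_variation (fun x y => (x - y) ^+ 2)).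
rewrite (avg_variation (fun x y => pos_part (x - y) ^+ 2)) mulrCA; congr (_ * _).
rewrite mulr_sumr; apply: eq_bigr => i _; rewrite mulr_sumr; apply: eq_bigr => j _.
under eq_avg do rewrite pos_part_sqrD opprB.
rewrite avgD mulr_natl mulr2n; congr (_ + _).
exact: esym (avg_tperm_swap (fun x y => pos_part (x - y) ^+ 2) f i j).
Qed.

Lemma variance_le_oneside f :
  E (fun g => (f g - E f) ^+ 2) <= E (oneside_variation f).
Proof.
apply: le_trans (variance_permutations f) _.
rewrite invfM -mulrA -(avg_variation (fun x y => (x - y) ^+ 2)).
by rewrite -/(twoside_variation f) avg_twoside_variation mulrA mulVf ?mul1r.
Qed.

(** By the reverse triangle inequality, passing to the absolute value does not increase
    differences. *)
Lemma norm_moment_bound f r : 2 <= r ->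
  E (fun g => `|f g - E f| `^ r) `^ r^-1 <=
  constD R * Num.sqrt r * E (fun g => twoside_variation f g `^ (r / 2)) `^ r^-1.
Proof.
move=> r2; apply: moment_bound => // [g|].
  rewrite /oneside_variation /twoside_variation ler_pM2l ?invr_gt0 ?ltr0n ?addn2//.
  apply: ler_sum => i _; apply: ler_sum => j _.
  rewrite -[leRHS]real_normK ?num_real// ler_pXn2r ?nnegrE ?pos_part_ge0//.
  apply: le_trans (pos_part_le_norm _) _; apply: le_trans (ler_dist_dist _ _) _.
  by rewrite le_eqVlt; apply/orP; left; apply/eqP; congr `|_|; ring.
under eq_avg do rewrite real_normK ?num_real//.
apply: le_trans (variance_le_oneside f) _; rewrite avg_twoside_variation.
have : 0 <= E (oneside_variation f).
  by apply: avg_ge0 => g _; exact: oneside_variation_ge0.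
lra.
Qed.

(** The positive part is nondecreasing and 1-Lipschitz, so it does not increase positive
    differences. *)
Lemma pos_part_moment_bound f r : 2 <= r ->
  E (fun g => pos_part (f g - E f) `^ r) `^ r^-1 <=
  constD R * Num.sqrt r * E (fun g => oneside_variation f g `^ (r / 2)) `^ r^-1.
Proof.
move=> r2; apply: moment_bound => // [g|g|]; first exact: pos_part_ge0.
  rewrite ler_pM2l ?invr_gt0 ?ltr0n ?addn2//.
  apply: ler_sum => i _; apply: ler_sum => j _.
  rewrite ler_pXn2r ?nnegrE ?pos_part_ge0//.
  set x := f g; set y := f _.
  rewrite {1}/pos_part ge_max pos_part_ge0 andbT lerBlDr /pos_part.
  rewrite ge_max; have := pos_part_ge0 (x - y); have := pos_part_ge0 (y - E f).
  rewrite /pos_part => h1 h2; rewrite addr_ge0// andbT.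
  have : x - y <= Num.max (x - y) 0 by rewrite le_max lexx.
  have : y - E f <= Num.max (y - E f) 0 by rewrite le_max lexx.
  lra.
apply: le_trans (variance_le_oneside f); apply: ler_avg => g _.
by rewrite [leRHS]pos_part_sqrD lerDl sqr_ge0.
Qed.

End permutation_moments.

(** * Uniform random permutations *)

Section uniform_permutation_moments.
Variables (R : realType) (d : measure_display) (T : measurableType d).
Variables (P : probability T R) (n : nat) (sigma : T -> 'S_n).
Hypothesis sigma_unif : uniform_permutation P sigma.

(** The integrand is a finite combination of indicators of the fibres of [sigma], each of
    probability 1/n!. *)
Lemma integral_uniform_permutation (G : 'S_n -> R) :
  (\int[P]_w (G (sigma w))%:E = (avg [set: 'S_n] G)%:E)%E.
Proof.
pose A (s : 'S_n) : set T := (sigma @^-1` [set s])%classic.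
have mA s : measurable (A s) by case: (sigma_unif s).
transitivity (\int[P]_w (\sum_s (G s)%:E * (\1_(A s) w)%:E))%E.
  apply: eq_integral => w _; rewrite (bigD1 (sigma w))//= big1 ?adde0.
    by rewrite indicE mem_set ?mule1.
  move=> s sw; rewrite indicE memNset ?mule0// /A/= => /esym/eqP.
  by rewrite (negbTE sw).
rewrite integral_sum//=; last first.
  by move=> s; apply: integrableZl => //; exact: integrable_indic.
rewrite /avg mulr_sumr -sumEFin [RHS](eq_bigl xpredT) => [|s]; last by rewrite inE.
apply: eq_bigr => s _; rewrite integralZl//; last exact: integrable_indic.
rewrite integral_indic// setIT; transitivity ((G s)%:E * (n`!%:R^-1)%:E)%E.
  by congr (_ * _)%E; case: (sigma_unif s).
by rewrite cardsT card_Sn -EFinM mulrC.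
Qed.

Lemma rnorm_uniform_permutation (r : R) (h : 'S_n -> R) :
  rnorm P r (h \o sigma) = ((avg [set: 'S_n] (fun s => `|h s| `^ r)) `^ r^-1)%:E.
Proof.
rewrite /rnorm unlock /=.
rewrite -poweR_EFin -(integral_uniform_permutation (fun s => `|h s| `^ r)).
by congr poweR; apply: eq_integral => w _ /=; rewrite poweR_EFin.
Qed.

End uniform_permutation_moments.

Theorem proposition4p8 (R : realType) (d : measure_display)
    (T : measurableType d) (P : probability T R) (n : nat)
    (sigma : T -> 'S_n) (sigma_unif : uniform_permutation P sigma)
    (f : 'S_n -> R) (r : R) (r_ge2 : 2 <= r) :
  let Ef : R := fine 'E_P[f \o sigma]%E in
  (rnorm P r (fun w => f (sigma w) - Ef)%R
     <= (constD R * Num.sqrt r)%R%:E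
        * rnorm P r (fun w => Num.sqrt ((n + 2)%:R^-1
            * \sum_(i < n) \sum_(j < n)
                (f (sigma w) - f (perm_comp (sigma w) (tperm i j))) ^+ 2))%R)%E
  /\
  (rnorm P r (fun w => pos_part (f (sigma w) - Ef))%R
     <= (constD R * Num.sqrt r)%R%:E
        * rnorm P r (fun w => Num.sqrt ((n + 2)%:R^-1
            * \sum_(i < n) \sum_(j < n)
                pos_part (f (sigma w) - f (perm_comp (sigma w) (tperm i j))) ^+ 2))%R)%E.
Proof.
move=> Ef.
have EfE : Ef = avg [set: 'S_n] f.
  by rewrite /Ef unlock (integral_uniform_permutation sigma_unif f).
have sqrt_powR (x : R) : 0 <= x -> `|Num.sqrt x| `^ r = x `^ (r / 2).
  by move=> x0; rewrite ger0_norm ?sqrtr_ge0// -powR12_sqrt// -powRrM mulrC.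
have two_ge0 g : 0 <= twoside_variation f g.
  rewrite mulr_ge0 ?invr_ge0// sumr_ge0// => i _.
  by rewrite sumr_ge0// => j _; exact: sqr_ge0.
have norm_sqrt (V : 'S_n -> R) : (forall g, 0 <= V g) ->
    rnorm P r (fun w => Num.sqrt (V (sigma w))) =
    ((avg [set: 'S_n] (fun g => V g `^ (r / 2))) `^ r^-1)%:E.
  move=> V0; rewrite (rnorm_uniform_permutation sigma_unif r (fun g => Num.sqrt (V g))).
  by congr (_ `^ _)%:E; apply: eq_avg => g _; exact: sqrt_powR.
split.
- rewrite (norm_sqrt (twoside_variation f))// EfE.
  rewrite (rnorm_uniform_permutation sigma_unif r (fun g => f g - avg [set: 'S_n] f)).
  by rewrite -EFinM lee_fin; exact: norm_moment_bound.
- rewrite (norm_sqrt (oneside_variation f)); last exact: oneside_variation_ge0.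
  rewrite EfE (rnorm_uniform_permutation sigma_unif r
    (fun g => pos_part (f g - avg [set: 'S_n] f))).
  rewrite -EFinM lee_fin; under eq_avg do rewrite ger0_norm ?pos_part_ge0//.
  exact: pos_part_moment_bound.
Qed.
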